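(* Let $\lambda\vdash n$ be a partition of $n$. When $\mathcal N_{S_n,1}(\tilde T_1)$ is written as a linear combination of the class elements, the coefficient of $\Gamma_\lambda$ is $[S_n:S_\lambda]\,\xi^{\,l_\lambda}$. Equivalently, $$\langle \mathcal N_{S_n,1}(\tilde T_1),\tilde T_{w_\lambda}\rangle=[S_n:S_\lambda]\,\xi^{\,l_\lambda}.$$
   Context: $S_n$ is the symmetric group with simple reflections $s_i=(i\ \ i+1)$, $1\le i\le n-1$, and length function $\ell$. The Iwahori--Hecke algebra $\mathcal H=\mathcal H_n$ is the associative $\mathbb Z[\xi]$-algebra ($\xi$ an indeterminate) with identity $\tilde T_1$, generated by $\tilde T_{s_1},\dots,\tilde T_{s_{n-1}}$ subject to the braid relations $\tilde T_{s_i}\tilde T_{s_j}=\tilde T_{s_j}\tilde T_{s_i}$ for $|i-j|\ge 2$, $\tilde T_{s_i}\tilde T_{s_{i+1}}\tilde T_{s_i}=\tilde T_{s_{i+1}}\tilde T_{s_i}\tilde T_{s_{i+1}}$, and $\tilde T_{s_i}^2=\tilde T_1+\xi\tilde T_{s_i}$. For a reduced expression $w=s_{i_1}\cdots s_{i_r}$ put $\tilde T_w=\tilde T_{s_{i_1}}\cdots\tilde T_{s_{i_r}}$; the $\tilde T_w$, $w\in S_n$, form a $\mathbb Z[\xi]$-basis. $Z(\mathcal H)$ is the centre. Specialization at $\xi=0$ gives the group algebra $\mathbb Z S_n$. For a partition $\lambda=(\lambda_1,\dots,\lambda_r)$ of $n$, $S_\lambda=S_{\lambda_1}\times\cdots\times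 S_{\lambda_r}\le S_n$ is the standard parabolic subgroup, with $i$-th factor generated by $s_{\lambda_1+\dots+\lambda_{i-1}+1},\dots,s_{\lambda_1+\dots+\lambda_i-1}$ (trivial if $\lambda_i=1$). The element $w_\lambda\in S_\lambda$ is the product over $i=1,\dots,r$ of $s_{\lambda_1+\dots+\lambda_{i-1}+1}\cdots s_{\lambda_1+\dots+\lambda_i-1}$ (in increasing order of indices; empty product if $\lambda_i=1$), and $l_\lambda=\ell(w_\lambda)$. The norm from the trivial subgroup is $\mathcal N_{S_n,1}(h)=\sum_{d\in S_n}\tilde T_{d^{-1}}h\tilde T_d$ for $h\in\mathcal H$; the element $\mathcal N_{S_n,1}(\tilde T_1)$ lies in $Z(\mathcal H)$. For $\lambda\vdash n$ let $C_\lambda$ be the conjugacy class of $S_n$ of cycle type $\lambda$. The class elements $\{\Gamma_\lambda\mid\lambda\vdash n\}$ are the elements of $Z(\mathcal H)$ characterized (Geck--Rouquier) by: $\Gamma_\lambda|_{\xi=0}=\sum_{w\in C_\lambda}w$, and in $\Gamma_\lambda-\sum_{w\in C_\lambda}\tilde T_w$ the coefficient of $\tilde T_w$ is zero whenever $w$ has minimal length in its conjugacy class. They form a $\mathbb Z[\xi]$-basis of $Z(\mathcal H)$. The form $\langle\ ,\ \rangle:\mathcal H\times\mathcal H\to\mathbb Z[\xi]$ is the $\mathbb Z[\xi]$-bilinear form with $\langle\tilde T_u,\tilde T_v\rangle=\delta_{u,v}$ for $u,v\in S_n$. *)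

(* Defs.v *)
From HB Require Import structures.
From mathcomp Require Import all_boot all_order all_fingroup all_algebra.
From mathcomp Require Import zify ring.

Set Implicit Arguments.
Unset Strict Implicit.
Unset Printing Implicit Defensive.

Import GRing.Theory.
Local Open Scope ring_scope.

Section SimpleReflections.
Variable n : nat.
Implicit Types (w u v : 'S_n) (i j : 'I_n.-1) (a b c : seq 'I_n.-1).

Fact sref_hi_subproof i : (i.+1 < n)%N. Proof. by case: i => /= i; lia. Qed.
Definition sref_lo i : 'I_n := widen_ord (leq_pred n) i.
Definition sref_hi i : 'I_n := Ordinal (sref_hi_subproof i).

(* Points and generators are numbered from 0: [sref i] exchanges the points i  *)
(* and i.+1 of {0, ..., n-1}. The product of permutations is (u * v) x =       *)
(* v (u x); only products of simple reflections matter, so this is harmless.   *)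
Definition sref i : 'S_n := tperm (sref_lo i) (sref_hi i).

Definition wperm a : 'S_n := (\prod_(i <- a) sref i)%g.

Definition ldes i w := (w (sref_hi i) < w (sref_lo i))%N.

Definition inv_set w := [set p : 'I_n * 'I_n | (p.1 < p.2)%N && (w p.2 < w p.1)%N].

Definition tr (k x : nat) := if x == k then k.+1 else if x == k.+1 then k else x.

Lemma srefE i (x : 'I_n) : sref i x = tr i x :> nat.
Proof.
rewrite /sref /tr; case: tpermP => [->|->|/eqP h1 /eqP h2] /=.
- by rewrite eqxx.
- by rewrite eqxx; case: eqP => //; lia.
by move: h1 h2; rewrite -!val_eqE /= => /negPf-> /negPf->.
Qed.

Lemma sref_invol i : (sref i * sref i)%g = 1%g.
Proof. exact: tperm2. Qed.

Lemma srefKl i w : (sref i * (sref i * w))%g = w.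
Proof. by rewrite mulgA sref_invol mul1g. Qed.

Lemma srefKr i w : (w * sref i * sref i)%g = w.
Proof. by rewrite -mulgA sref_invol mulg1. Qed.

Lemma srefV i : (sref i)^-1%g = sref i.
Proof. exact: tpermV. Qed.

Lemma sref_lohi i : sref i (sref_lo i) = sref_hi i. Proof. exact: tpermL. Qed.
Lemma sref_hilo i : sref i (sref_hi i) = sref_lo i. Proof. exact: tpermR. Qed.

Lemma perm_val_neq w (x y : 'I_n) : x != y :> nat -> w x != w y :> nat.
Proof. by apply: contra => /eqP/val_inj/perm_inj->. Qed.

Lemma ldes_sref i w : ldes i (sref i * w) = ~~ ldes i w.
Proof.
rewrite /ldes !permM sref_lohi sref_hilo -leqNgt.
have ne : w (sref_lo i) != w (sref_hi i) :> nat.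
  by apply: perm_val_neq; rewrite /= neq_ltn ltnSn.
by rewrite [RHS]leq_eqVlt (negPf ne).
Qed.

Lemma inv_sref_up i w : ~~ ldes i w -> #|inv_set (sref i * w)| = #|inv_set w|.+1.
Proof.
move=> nd; pose p0 := (sref_lo i, sref_hi i).
have d : ldes i (sref i * w) by rewrite ldes_sref.
have in0 : p0 \in inv_set (sref i * w) by rewrite inE /= ltnSn -/(ldes i _) d.
have nin0 : p0 \notin inv_set w by rewrite inE /= -/(ldes i w) (negPf nd) andbF.
rewrite (cardsD1 p0) in0 add1n; congr _.+1.
pose f (p : 'I_n * 'I_n) := (sref i p.1, sref i p.2).
have fK : involutive f.
  by case=> x y; rewrite /f /= -!permM sref_invol !perm1.
have ordf (p : 'I_n * 'I_n) : p != p0 -> (p.1 < p.2)%N -> ((f p).1 < (f p).2)%N.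
  case: p => x y; rewrite xpair_eqE negb_and -!val_eqE /= !srefE /tr.
  by do !case: eqP => //=; lia.
have f0 (p : 'I_n * 'I_n) : (p.1 < p.2)%N -> f p != p0.
  case: p => x y /= xy; apply/eqP=> -[/(congr1 val) + /(congr1 val)].
  by rewrite /= !srefE /tr; do !case: eqP => //=; lia.
rewrite -(card_imset (mem (inv_set w)) (can_inj fK)).
apply: eq_card => p; rewrite -[p in RHS]fK mem_imset; last exact: can_inj fK.
rewrite !inE /= !permM.
apply/idP/idP.
  by case/and3P=> pn lt12 wlt; rewrite wlt andbT; apply: (ordf p).
case/andP=> lt12 wlt; rewrite wlt andbT.
have pn := f0 (f p) lt12; rewrite fK in pn; rewrite pn /=.
have fn : f p != p0.
  apply: contraNneq nin0 => <-.
  by rewrite inE lt12.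
by have := ordf (f p) fn lt12; rewrite fK.
Qed.

Lemma inv_sref_down i w : ldes i w -> #|inv_set w| = #|inv_set (sref i * w)|.+1.
Proof.
by move=> d; rewrite -(@inv_sref_up i) ?srefKl // ldes_sref negbK.
Qed.

Lemma no_ldes w : (forall i, ~~ ldes i w) -> w = 1%g.
Proof.
move=> nd.
have mono (x y : 'I_n) : (x < y)%N -> (w x < w y)%N.
  case: y => y; elim: y x => [//|y IHy] x yn /= xy.
  have yn1 : (y < n.-1)%N by lia.
  have step : (w (Ordinal (ltnW yn)) < w (Ordinal yn))%N.
    have := nd (Ordinal yn1); rewrite /ldes -leqNgt leq_eqVlt.
    have -> : sref_lo (Ordinal yn1) = Ordinal (ltnW yn) by apply: val_inj.
    have -> : sref_hi (Ordinal yn1) = Ordinal yn by apply: val_inj.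
    case/orP=> // /eqP/val_inj/perm_inj/(congr1 val) /=; lia.
  have [->|ne] := eqVneq x (Ordinal (ltnW yn)); first exact: step.
  apply: ltn_trans step; apply: IHy => /=.
  by move: ne; rewrite -val_eqE /=; lia.
have ge (x : 'I_n) : (x <= w x)%N.
  case: x => x; elim: x => [//|x IHx] xn.
  have := IHx (ltnW xn) => /= h; apply: leq_ltn_trans h _.
  exact: mono.
have sumE : (\sum_(x < n) w x = \sum_(x < n) x)%N.
  by rewrite [RHS](reindex_inj (@perm_inj _ w)).
have := @leqif_sum _ xpredT (fun x : 'I_n => x == w x :> nat)
  (fun x : 'I_n => val x) (fun x => val (w x)).
move=> /(_ (fun x _ => conj (ge x) erefl)) [_].
rewrite /= sumE eqxx => /esym/forallP h; apply/permP => x; rewrite perm1.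
by apply/val_inj/esym/eqP; move: (h x).
Qed.

Lemma wperm_nil : wperm [::] = 1%g. Proof. exact: big_nil. Qed.
Lemma wperm_cons i a : wperm (i :: a) = (sref i * wperm a)%g.
Proof. exact: big_cons. Qed.
Lemma wperm_cat a b : wperm (a ++ b) = (wperm a * wperm b)%g.
Proof. exact: big_cat. Qed.

Lemma inv_wperm a : (#|inv_set (wperm a)| <= size a)%N.
Proof.
elim: a => [|i a IH].
  rewrite wperm_nil leqn0 cards_eq0; apply/eqP/setP=> -[x y].
  rewrite !inE /= !perm1; lia.
rewrite wperm_cons /=; have [d|nd] := boolP (ldes i (wperm a)).
  by rewrite (inv_sref_down d) in IH; apply: leqW; apply: ltnW.
by rewrite inv_sref_up.
Qed.

Lemma wperm_inv w : exists2 a, wperm a = w & size a = #|inv_set w|.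
Proof.
have [k] := ubnP #|inv_set w|; elim: k w => // k IH w le_k.
have [/existsP[i d]|/existsPn nd] := boolP [exists i, ldes i w].
  have E := inv_sref_down d.
  have [|a aw sa] := IH (sref i * w)%g; first by rewrite -ltnS -E.
  exists (i :: a); first by rewrite wperm_cons aw srefKl.
  by rewrite /= sa E.
have w1 : w = 1%g by apply: no_ldes => i; apply: nd.
by exists [::]; rewrite ?wperm_nil ?w1 //; have := inv_wperm [::];
  rewrite wperm_nil leqn0 => /eqP->.
Qed.

Fact sref_generate w :
  exists k, [exists a : k.-tuple 'I_n.-1, wperm a == w].
Proof.
have [a aw _] := wperm_inv w.
by exists (size a); apply/existsP; exists (in_tuple a); rewrite /= aw.
Qed.

Definition ell w : nat := ex_minn (sref_generate w).

Definition reduced a := size a == ell (wperm a).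

Lemma ell_inv w : ell w = #|inv_set w|.
Proof.
rewrite /ell; case: ex_minnP => k /existsP[a /eqP aw] kmin.
apply/eqP; rewrite eqn_leq; apply/andP; split.
  have [b bw <-] := wperm_inv w; apply: kmin; apply/existsP.
  by exists (in_tuple b); rewrite /= bw.
by rewrite -aw (leq_trans (inv_wperm a)) // size_tuple.
Qed.

Fact rword_subproof w : exists a, (wperm a == w) && (size a == ell w).
Proof. by have [a aw sa] := wperm_inv w; exists a; rewrite aw ell_inv sa !eqxx. Qed.

Definition rword w : seq 'I_n.-1 := xchoose (rword_subproof w).

Lemma rwordP w : wperm (rword w) = w.
Proof. by have /andP[/eqP] := xchooseP (rword_subproof w). Qed.
Lemma size_rword w : size (rword w) = ell w.
Proof. by have /andP[_ /eqP] := xchooseP (rword_subproof w). Qed.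
Lemma rword_reduced w : reduced (rword w).
Proof. by rewrite /reduced rwordP size_rword. Qed.

Lemma ell_wperm a : (ell (wperm a) <= size a)%N.
Proof. by rewrite ell_inv inv_wperm. Qed.

Lemma ell1 : ell 1%g = 0%N.
Proof. by apply/eqP; rewrite -leqn0 -wperm_nil ell_wperm. Qed.

Lemma ell_up i w : ~~ ldes i w -> ell (sref i * w) = (ell w).+1.
Proof. by rewrite !ell_inv; apply: inv_sref_up. Qed.
Lemma ell_down i w : ldes i w -> ell w = (ell (sref i * w)).+1.
Proof. by rewrite !ell_inv; apply: inv_sref_down. Qed.

Lemma ell_ldes i w : (ell (sref i * w) < ell w)%N = ldes i w.
Proof.
have [d|nd] := boolP (ldes i w); first by rewrite [ell w](ell_down d) ltnSn.
by rewrite (ell_up nd) ltnNge leqnSn.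
Qed.

Lemma ellV w : ell w^-1%g = ell w.
Proof.
suff le v : (ell v^-1%g <= ell v)%N.
  by apply/eqP; rewrite eqn_leq le -{1}[w]invgK le.
have <- : wperm (rev (rword v)) = v^-1%g.
  rewrite -[in RHS](rwordP v); elim: (rword v) => [|i a IH].
    by rewrite wperm_nil invg1.
  by rewrite wperm_cons invMg -IH rev_cons -cats1 wperm_cat wperm_cons
    wperm_nil mulg1 srefV.
by rewrite -(size_rword v) -size_rev; apply: ell_wperm.
Qed.

Lemma ell_ldesV i w : (ell (w * sref i) < ell w)%N = ldes i w^-1.
Proof. by rewrite -ell_ldes ellV -(ellV (w * sref i)) invMg srefV. Qed.

Lemma reduced_cons i a :
  reduced (i :: a) -> reduced a /\ ldes i (wperm (i :: a)).
Proof.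
rewrite /reduced /= => /eqP E; rewrite wperm_cons in E *.
have [d|nd] := boolP (ldes i (sref i * wperm a)).
  split=> //; have := ell_down d; rewrite srefKl -E => -[->] //.
exfalso; move: nd; rewrite ldes_sref negbK => d.
by have := ell_wperm a; rewrite (ell_down d) -E; lia.
Qed.

Lemma ldes_mulr i j w :
  (sref i * w != w * sref j)%g -> ldes i (w * sref j) = ldes i w.
Proof.
move=> ne; rewrite /ldes !permM !srefE.
set x := w (sref_hi i); set y := w (sref_lo i).
have nxy : x != y :> nat by apply: perm_val_neq => /=; rewrite neq_ltn ltnSn orbT.
have h1 : ~ (x = sref_hi j :> nat /\ y = sref_lo j :> nat).
  case=> /val_inj Ex /val_inj Ey; case/eqP: ne.
  by rewrite [LHS]conjgC /conjg -/(conjg _ _) tpermJ -/x -/y Ex Ey.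
have h2 : ~ (x = sref_lo j :> nat /\ y = sref_hi j :> nat).
  case=> /val_inj Ex /val_inj Ey; case/eqP: ne.
  by rewrite [LHS]conjgC /conjg -/(conjg _ _) tpermJ -/x -/y Ex Ey tpermC.
move: nxy h1 h2; rewrite /= /tr; by do !case: eqP => //=; lia.
Qed.

End SimpleReflections.

(* An element h is given by its coefficients [hcoef h w] in the basis T_w; the *)
(* indeterminate xi is ['X : {poly int}]. The multiplication is defined below, *)
(* and [hecke_universal] shows that the resulting algebra is the one given by  *)
(* the generators T_s and the braid and quadratic relations.                   *)
Record hecke (n : nat) : Type := Hecke { hcoef : {ffun 'S_n -> {poly int}} }.

Section HeckeModule.
Variable n : nat.
Implicit Types (h k : hecke n) (w : 'S_n) (a : {poly int}).

HB.instance Definition _ := [isNew for @hcoef n].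
HB.instance Definition _ := [Choice of hecke n by <:].

Lemma heckeP h k : (forall w, hcoef h w = hcoef k w) -> h = k.
Proof. by move=> hk; apply: val_inj; apply/ffunP. Qed.

Let add h k := Hecke [ffun w => hcoef h w + hcoef k w].
Let opp h := Hecke [ffun w => - hcoef h w].
Let zero : hecke n := Hecke [ffun=> 0].
Let scale a h := Hecke [ffun w => a * hcoef h w].

Fact hecke_addA : associative add.
Proof. by move=> h k m; apply: heckeP => w; rewrite !ffunE addrA. Qed.
Fact hecke_addC : commutative add.
Proof. by move=> h k; apply: heckeP => w; rewrite !ffunE addrC. Qed.
Fact hecke_add0 : left_id zero add.
Proof. by move=> h; apply: heckeP => w; rewrite !ffunE add0r. Qed.
Fact hecke_addN : left_inverse zero opp add.
Proof. by move=> h; apply: heckeP => w; rewrite !ffunE addNr. Qed.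

HB.instance Definition _ :=
  GRing.isZmodule.Build (hecke n) hecke_addA hecke_addC hecke_add0 hecke_addN.

Fact hecke_scaleA a b h : scale a (scale b h) = scale (a * b) h.
Proof. by apply: heckeP => w; rewrite !ffunE mulrA. Qed.
Fact hecke_scale1 : left_id 1 scale.
Proof. by move=> h; apply: heckeP => w; rewrite !ffunE mul1r. Qed.
Fact hecke_scaleDr : right_distributive scale +%R.
Proof. by move=> a h k; apply: heckeP => w; rewrite !ffunE mulrDr. Qed.
Fact hecke_scaleDl h : {morph scale^~ h : a b / a + b}.
Proof. by move=> a b; apply: heckeP => w; rewrite !ffunE mulrDl. Qed.

HB.instance Definition _ := GRing.Zmodule_isLmodule.Build {poly int} (hecke n)
  hecke_scaleA hecke_scale1 hecke_scaleDr hecke_scaleDl.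

Lemma hcoef0 w : hcoef (0 : hecke n) w = 0. Proof. by rewrite ffunE. Qed.
Lemma hcoefD h k w : hcoef (h + k) w = hcoef h w + hcoef k w.
Proof. by rewrite ffunE. Qed.
Lemma hcoefN h w : hcoef (- h) w = - hcoef h w.
Proof. by rewrite ffunE. Qed.
Lemma hcoefB h k w : hcoef (h - k) w = hcoef h w - hcoef k w.
Proof. by rewrite hcoefD hcoefN. Qed.
Lemma hcoefZ a h w : hcoef (a *: h) w = a * hcoef h w.
Proof. by rewrite ffunE. Qed.
Lemma hcoef_sum I (r : seq I) (P : pred I) (F : I -> hecke n) w :
  hcoef (\sum_(i <- r | P i) F i) w = \sum_(i <- r | P i) hcoef (F i) w.
Proof.
by elim/big_rec2: _ => [|i x y _ <-]; rewrite ?hcoef0 ?hcoefD.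
Qed.

Definition T w : hecke n := Hecke [ffun v => (v == w)%:R].

Lemma hcoefT w v : hcoef (T w) v = (v == w)%:R.
Proof. by rewrite ffunE. Qed.

Lemma hecke_sumT h : h = \sum_w hcoef h w *: T w.
Proof.
apply: heckeP => v; rewrite hcoef_sum (bigD1 v) // big1.
  by rewrite hcoefZ hcoefT eqxx /= mulr1 addr0.
by move=> w /andP[_ wv]; rewrite hcoefZ hcoefT eq_sym (negPf wv) mulr0.
Qed.

End HeckeModule.

Section HeckeMultiplication.
Variable n : nat.
Implicit Types (h k : hecke n) (w u v : 'S_n) (i j : 'I_n.-1).

(* Left multiplication by T_s (s = sref i), read off the coefficients: by the  *)
(* quadratic relation, T_s T_w is T_(sw) if sw is longer than w, and           *)
(* T_(sw) + xi T_w otherwise.                                                  *)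
Definition lop i h : hecke n := Hecke
  [ffun w => hcoef h (sref i * w)%g +
     (ell (sref i * w) < ell w)%N%:R * ('X * hcoef h w)].

Definition rop i h : hecke n := Hecke
  [ffun w => hcoef h (w * sref i)%g +
     (ell (w * sref i) < ell w)%N%:R * ('X * hcoef h w)].

Lemma lopE i h w : hcoef (lop i h) w =
  hcoef h (sref i * w)%g + (ldes i w)%:R * ('X * hcoef h w).
Proof. by rewrite ffunE ell_ldes. Qed.

Lemma ropE i h w : hcoef (rop i h) w =
  hcoef h (w * sref i)%g + (ldes i w^-1)%:R * ('X * hcoef h w).
Proof. by rewrite ffunE ell_ldesV. Qed.

#[local] Opaque lop rop.

Definition hecke_mul h k : hecke n :=
  \sum_w hcoef h w *: foldr lop k (rword w).

Fact lop_is_linear i : linear (lop i).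
Proof.
move=> a h k; apply: heckeP => w.
rewrite hcoefD hcoefZ !lopE !hcoefD !hcoefZ; ring.
Qed.
HB.instance Definition _ i :=
  GRing.isLinear.Build {poly int} (hecke n) (hecke n) *:%R (lop i) (lop_is_linear i).

Fact rop_is_linear i : linear (rop i).
Proof.
move=> a h k; apply: heckeP => w.
rewrite hcoefD hcoefZ !ropE !hcoefD !hcoefZ; ring.
Qed.
HB.instance Definition _ i :=
  GRing.isLinear.Build {poly int} (hecke n) (hecke n) *:%R (rop i) (rop_is_linear i).

Fact fold_lop_is_linear (a : seq 'I_n.-1) : linear (fun k => foldr lop k a).
Proof.
by move=> c h k; elim: a => //= i a ->; rewrite linearP.
Qed.

Fact hecke_mul_is_linear h : linear (hecke_mul h).
Proof.
move=> c k m; rewrite /hecke_mul scaler_sumr -big_split; apply: eq_bigr => w _ /=.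
by rewrite (fold_lop_is_linear (rword w) c) scalerDr !scalerA mulrC.
Qed.
HB.instance Definition _ h := GRing.isLinear.Build {poly int} (hecke n) (hecke n) *:%R
  (hecke_mul h) (hecke_mul_is_linear h).

Lemma lop_rop i j h : lop i (rop j h) = rop j (lop i h).
Proof.
apply: heckeP => w.
apply: etrans (lopE _ _ _) _; apply: esym; apply: etrans (ropE _ _ _) _.
pose F d x y : {poly int} := x + d%:R * ('X * y).
apply: etrans (congr2 (F (ldes j w^-1)) (lopE _ _ _) (lopE _ _ _)) _.
apply: esym.
apply: etrans (congr2 (F (ldes i w)) (ropE _ _ _) (ropE _ _ _)) _; rewrite {}/F.
rewrite mulgA.
have [E|ne] := eqVneq (sref i * w)%g (w * sref j)%g.
  have d1 : ldes i (w * sref j) = ~~ ldes i w by rewrite -E ldes_sref.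
  have d2 : ldes j (sref i * w)^-1 = ~~ ldes j w^-1.
    by rewrite E invMg srefV ldes_sref.
  have d3 : ldes i w = ldes j w^-1 by rewrite -ell_ldes -ell_ldesV E.
  rewrite d1 d2 d3 E; case: (ldes j _) => /=; ring.
rewrite (ldes_mulr ne).
have ne' : (sref j * w^-1 != w^-1 * sref i)%g.
  by apply: contraNneq ne => /(congr1 invg); rewrite !invMg !srefV !invgK => ->.
rewrite invMg srefV (ldes_mulr ne'); ring.
Qed.

Lemma lopT i w : lop i (T w) =
  T (sref i * w)%g + (ldes i w)%:R *: ('X *: T w).
Proof.
apply: heckeP => v; rewrite lopE hcoefD !hcoefZ !hcoefT.
rewrite -(can_eq (srefKl i)) srefKl; congr (_ + _).
by case: (eqVneq v w) => [->//|_]; rewrite !mulr0.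
Qed.

Lemma ropT i w : rop i (T w) =
  T (w * sref i)%g + (ldes i w^-1)%:R *: ('X *: T w).
Proof.
apply: heckeP => v; rewrite ropE hcoefD !hcoefZ !hcoefT.
have -> : (v * sref i == w)%g = (v == w * sref i)%g.
  by apply/eqP/eqP => [<-|->]; rewrite srefKr.
congr (_ + _).
by case: (eqVneq v w) => [->//|_]; rewrite !mulr0.
Qed.

Lemma fold_lopT a : reduced a -> foldr lop (T 1) a = T (wperm a).
Proof.
elim: a => [|i a IH] => [_|/reduced_cons[ra]] /=; first by rewrite wperm_nil.
by rewrite wperm_cons ldes_sref => /negPf nd; rewrite (IH ra) lopT nd scale0r addr0.
Qed.

Lemma rop_ext (f g : {linear hecke n -> hecke n}) :
    (forall i h, f (rop i h) = rop i (f h)) ->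
    (forall i h, g (rop i h) = rop i (g h)) ->
  f (T 1) = g (T 1) -> f =1 g.
Proof.
move=> fC gC fg1; suff fgT w : f (T w) = g (T w).
  move=> h; rewrite [h]hecke_sumT !linear_sum; apply: eq_bigr => w _.
  by rewrite !linearZ /= fgT.
have [m] := ubnP (ell w); elim: m w => // m IH w le_m.
have [/existsP[i d]|/existsPn nd] := boolP [exists i, ldes i w^-1].
  have E : T w = rop i (T (w * sref i)%g).
    rewrite ropT srefKr invMg srefV ldes_sref d scale0r addr0 //.
  rewrite E fC gC IH //; apply: leq_trans (le_m : (ell w <= m)%N).
  by rewrite ell_ldesV.
have/no_ldes wV1 : forall i, ~~ ldes i w^-1 by [].
by have -> : w = 1%g; first by rewrite -[w]invgK wV1 invg1.
Qed.

Lemma fold_lop_rop i a h : foldr lop (rop i h) a = rop i (foldr lop h a).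
Proof. by elim: a => //= j a ->; rewrite lop_rop. Qed.

Lemma hecke_mul_rop i h k : hecke_mul h (rop i k) = rop i (hecke_mul h k).
Proof.
rewrite /hecke_mul linear_sum; apply: eq_bigr => w _.
by rewrite linearZ /= fold_lop_rop.
Qed.

Fact hecke_mulr1 : right_id (T 1) hecke_mul.
Proof.
move=> h; rewrite [RHS]hecke_sumT; apply: eq_bigr => w _.
by rewrite fold_lopT ?rword_reduced // rwordP.
Qed.

Fact hecke_mul1r : left_id (T 1) hecke_mul.
Proof.
apply: (rop_ext (f := hecke_mul (T 1)) (g := idfun)) => //.
  by move=> i h; apply: hecke_mul_rop.
exact: hecke_mulr1.
Qed.

Fact hecke_mulA : associative hecke_mul.
Proof.
move=> h k m; pose f := hecke_mul h \o hecke_mul k.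
apply: (rop_ext (f := f) (g := hecke_mul (hecke_mul h k))).
- by move=> i x; rewrite -[LHS]/(hecke_mul h (hecke_mul k (rop i x))) !hecke_mul_rop.
- by move=> i x; apply: hecke_mul_rop.
exact: etrans (congr1 (hecke_mul h) (hecke_mulr1 k)) (esym (hecke_mulr1 _)).
Qed.

Fact hecke_mulDl : left_distributive hecke_mul +%R.
Proof.
move=> h k m; rewrite /hecke_mul -big_split; apply: eq_bigr => w _.
by rewrite hcoefD scalerDl.
Qed.

Fact hecke_mulDr : right_distributive hecke_mul +%R.
Proof. by move=> h k m; rewrite linearD. Qed.

Fact hecke_1neq0 : T 1 != 0 :> hecke n.
Proof.
apply/eqP => /(congr1 (fun h => hcoef h 1%g)); rewrite hcoefT hcoef0 eqxx.
by move/eqP; rewrite oner_eq0.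
Qed.

HB.instance Definition _ := GRing.Zmodule_isNzRing.Build (hecke n)
  hecke_mulA hecke_mul1r hecke_mulr1 hecke_mulDl hecke_mulDr hecke_1neq0.

Fact hecke_scaleAl (a : {poly int}) h k : a *: (h * k) = (a *: h) * k.
Proof.
rewrite [LHS]scaler_sumr; apply: eq_bigr => w _.
by rewrite hcoefZ scalerA.
Qed.

Fact hecke_scaleAr (a : {poly int}) h k : a *: (h * k) = h * (a *: k).
Proof. exact/esym/(linearZ_LR (hecke_mul h)). Qed.

HB.instance Definition _ :=
  GRing.Lmodule_isLalgebra.Build {poly int} (hecke n) hecke_scaleAl.
HB.instance Definition _ :=
  GRing.Lalgebra_isAlgebra.Build {poly int} (hecke n) hecke_scaleAr.

Lemma hecke1E : 1 = T 1 :> hecke n. Proof. by []. Qed.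

Lemma mulTs i h : T (sref i) * h = lop i h.
Proof.
apply: (rop_ext (f := hecke_mul (T (sref i))) (g := lop i)).
- by move=> j k; apply: hecke_mul_rop.
- by move=> j k; apply: lop_rop.
apply: etrans (hecke_mulr1 _) _; apply/esym; apply: etrans (lopT _ _) _.
rewrite mulg1.
by rewrite -ell_ldes ell1 ltn0 scale0r addr0.
Qed.

Lemma mulTsT i w : T (sref i) * T w =
  if ldes i w then T (sref i * w)%g + 'X *: T w else T (sref i * w)%g.
Proof.
by rewrite mulTs lopT; case: ldes; rewrite ?scale1r ?scale0r ?addr0.
Qed.

(* T_w is the product of the generators along any reduced expression of w.     *)
Lemma T_reduced (a : seq 'I_n.-1) :
  reduced a -> T (wperm a) = \prod_(i <- a) T (sref i).
Proof.
move=> /fold_lopT <-; elim: a => [|i a IH] /=; first by rewrite big_nil.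
by rewrite big_cons -IH mulTs.
Qed.

End HeckeMultiplication.

Section HeckePresentation.
Variable n : nat.
Implicit Types (h k : hecke n) (w u v : 'S_n) (i j : 'I_n.-1) (a b c : seq 'I_n.-1).

Definition hecke_relations (A : algType {poly int}) (t : 'I_n.-1 -> A) : Prop :=
  [/\ forall i j, (i.+1 < j)%N -> t i * t j = t j * t i,
      forall i j, j = i.+1 :> nat -> t i * t j * t i = t j * t i * t j
    & forall i, t i * t i = 1 + 'X *: t i].

Lemma sref_commute i j : (i.+1 < j)%N -> (sref i * sref j = sref j * sref i)%g.
Proof.
move=> ij; apply/permP => x; apply: val_inj; rewrite /= !permM !srefE /tr.
by do !case: eqP => //=; lia.
Qed.

Lemma sref_braid i j : j = i.+1 :> nat ->
  (sref i * (sref j * sref i) = sref j * (sref i * sref j))%g.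
Proof.
move=> ij; apply/permP => x; apply: val_inj; rewrite /= !permM !srefE /tr ij.
by do !case: eqP => //=; lia.
Qed.

Lemma ldes_commute i j w : (i.+1 < j)%N || (j.+1 < i)%N ->
  ldes j (sref i * w) = ldes j w.
Proof.
move=> ij; rewrite /ldes !permM.
have -> : sref i (sref_hi j) = sref_hi j.
  by apply: val_inj; rewrite /= srefE /tr /=; do !case: eqP => //=; lia.
have -> // : sref i (sref_lo j) = sref_lo j.
by apply: val_inj; rewrite /= srefE /tr /=; do !case: eqP => //=; lia.
Qed.

Lemma ldes_braid i j w : j = i.+1 :> nat -> ldes i w -> ldes j w ->
  ldes j (sref i * w) /\ ldes i (sref j * (sref i * w)).
Proof.
move=> ij; rewrite /ldes !permM.
have -> : sref i (sref_hi j) = sref_hi j.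
  by apply: val_inj; rewrite /= srefE /tr /=; do !case: eqP => //=; lia.
have E : sref_lo j = sref_hi i by apply: val_inj.
rewrite E (sref_hilo i) -E (sref_lohi j).
have -> : sref j (sref_lo i) = sref_lo i.
  by apply: val_inj; rewrite /= srefE /tr /=; do !case: eqP => //=; lia.
have -> : sref i (sref_hi j) = sref_hi j.
  by apply: val_inj; rewrite /= srefE /tr /=; do !case: eqP => //=; lia.
by rewrite sref_lohi E; move=> d1 d2; split=> //; apply: ltn_trans d2 d1.
Qed.

Lemma ldes_braid' i j w : j = i.+1 :> nat -> ldes i w -> ldes j w ->
  ldes i (sref j * w) /\ ldes j (sref i * (sref j * w)).
Proof.
move=> ij; rewrite /ldes !permM.
have -> : sref j (sref_lo i) = sref_lo i.
  by apply: val_inj; rewrite /= srefE /tr /=; do !case: eqP => //=; lia.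
have E : sref_lo j = sref_hi i by apply: val_inj.
have -> : sref i (sref_hi j) = sref_hi j.
  by apply: val_inj; rewrite /= srefE /tr /=; do !case: eqP => //=; lia.
rewrite E (sref_hilo i) -E (sref_lohi j) (sref_hilo j).
have -> : sref j (sref_lo i) = sref_lo i.
  by apply: val_inj; rewrite /= srefE /tr /=; do !case: eqP => //=; lia.
by rewrite E; move=> d1 d2; split=> //; apply: ltn_trans d2 d1.
Qed.

Lemma reduced_ldes i a :
  reduced (i :: a) = reduced a && ~~ ldes i (wperm a).
Proof.
apply/idP/andP => [/reduced_cons[ra]|[/eqP ra nd]].
  by rewrite wperm_cons ldes_sref.
by rewrite /reduced /= wperm_cons ell_up // ra.
Qed.

Lemma hecke_relationsT : hecke_relations (fun i => T (sref i) : hecke n).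
Proof.
have ld1 i : ldes i 1 = false by rewrite -ell_ldes ell1 ltn0.
have ldi i : ldes i (sref i) by rewrite -[sref i]mulg1 ldes_sref ld1.
have ldj i j : i != j -> ldes i (sref j) = false.
  move=> ij; apply/negbTE; rewrite /ldes -leqNgt !srefE /tr /=.
  by move: ij; rewrite -val_eqE /=; do !case: eqP => //=; lia.
split=> [i j ij|i j ij|i].
- have nij : i != j by rewrite -val_eqE /= neq_ltn (ltnW ij).
  have nji : j != i by rewrite eq_sym.
  by rewrite (mulTsT i) (mulTsT j) (ldj i j nij) (ldj j i nji) (sref_commute ij).
- have nij : i != j by rewrite -val_eqE /= ij neq_ltn ltnSn.
  have nji : j != i by rewrite eq_sym.
  have d1 : ldes i (sref j * sref i) = false.
    apply/negbTE; rewrite /ldes !permM -leqNgt !srefE /tr /= ij.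
    by do !case: eqP => //=; lia.
  have d2 : ldes j (sref i * sref j) = false.
    apply/negbTE; rewrite /ldes !permM -leqNgt !srefE /tr /= ij.
    by do !case: eqP => //=; lia.
  rewrite -!mulrA (mulTsT i (sref j)) (mulTsT j (sref i)).
  rewrite (ldj i j nij) (ldj j i nji).
  rewrite (mulTsT i (sref j * sref i)) (mulTsT j (sref i * sref j)) d1 d2.
  by rewrite (sref_braid ij).
by rewrite mulTsT ldi sref_invol.
Qed.

Section Universal.
Variables (A : algType {poly int}) (t : 'I_n.-1 -> A).
Hypothesis tR : hecke_relations t.

Let tw a := \prod_(i <- a) t i.

Fact matsumoto a b : reduced a -> reduced b -> wperm a = wperm b -> tw a = tw b.
Proof.
have [tC tB _] := tR.
have [m] := ubnP (size a); elim: m a b => // m IH a b.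
case: a => [_ _ /eqP rb|i a /= le_m rea].
  by rewrite wperm_nil => E; move: rb; rewrite -E ell1 => /size0nil->.
have [ra d1] := reduced_cons rea; rewrite wperm_cons in d1 *.
case: b => [_|j b reb].
  by move: rea; rewrite /reduced /= wperm_cons wperm_nil => /eqP + E;
    rewrite E ell1.
have [rb d2] := reduced_cons reb; rewrite wperm_cons in d2 *.
set w := (sref i * wperm a)%g => E; rewrite -/w in d1; rewrite -E in d2.
have aE : wperm a = (sref i * w)%g by rewrite srefKl.
have bE : wperm b = (sref j * w)%g by rewrite E srefKl.
have sE : size a = size b.
  move: rea reb; rewrite /reduced !wperm_cons -/w -E => /eqP + /eqP + /=.
  by move=> <- [].
have step a' x : reduced a' -> (size a' <= size a)%N -> reduced x ->
    wperm x = wperm a' -> tw a' = tw x.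
  by move=> ra' sa' rx Ex; apply: IH => //; apply: leq_ltn_trans sa' le_m.
rewrite /tw !big_cons -/(tw a) -/(tw b).
have [ij|nij] := eqVneq i j.
  by rewrite -ij; congr (_ * _); apply: step => //; rewrite aE bE ij.
have comm i' j' a' b' : (i'.+1 < j')%N -> reduced a' -> reduced b' ->
    (size a' <= size a)%N -> (size b' <= size a)%N ->
    wperm a' = (sref i' * w)%g -> wperm b' = (sref j' * w)%g ->
    ldes i' w -> ldes j' w -> t i' * tw a' = t j' * tw b'.
  move=> ij ra' rb' sa' sb' aE' bE' di dj.
  pose c := rword (sref j' * (sref i' * w))%g.
  have cE : wperm c = (sref j' * (sref i' * w))%g by apply: rwordP.
  have cE' : wperm c = (sref i' * (sref j' * w))%g.
    by rewrite cE !mulgA (sref_commute ij).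
  have rc : reduced c by apply: rword_reduced.
  have r1 : reduced (j' :: c).
    by rewrite reduced_ldes rc cE ldes_sref negbK ldes_commute ?ij.
  have r2 : reduced (i' :: c).
    by rewrite reduced_ldes rc cE' ldes_sref negbK ldes_commute ?ij ?orbT.
  rewrite (step a' (j' :: c)) // ?(wperm_cons, cE, srefKl) //.
  rewrite (step b' (i' :: c)) // ?(wperm_cons, cE', srefKl) //.
  by rewrite /tw !big_cons !mulrA tC.
have braid i' j' a' b' : j' = i'.+1 :> nat -> reduced a' -> reduced b' ->
    (size a' <= size a)%N -> (size b' <= size a)%N ->
    wperm a' = (sref i' * w)%g -> wperm b' = (sref j' * w)%g ->
    ldes i' w -> ldes j' w -> t i' * tw a' = t j' * tw b'.
  move=> ij ra' rb' sa' sb' aE' bE' di dj.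
  have [e1 e2] := ldes_braid ij di dj; have [f1 f2] := ldes_braid' ij di dj.
  pose c := rword (sref i' * (sref j' * (sref i' * w)))%g.
  have cE : wperm c = (sref i' * (sref j' * (sref i' * w)))%g by apply: rwordP.
  have cE' : wperm c = (sref j' * (sref i' * (sref j' * w)))%g.
    by rewrite cE; have := sref_braid ij; rewrite !mulgA => ->.
  have rc : reduced c by apply: rword_reduced.
  have r1 : reduced [:: j', i' & c].
    by rewrite !reduced_ldes rc !wperm_cons cE !srefKl !ldes_sref !negbK e1 e2.
  have r2 : reduced [:: i', j' & c].
    by rewrite !reduced_ldes rc !wperm_cons cE' !srefKl !ldes_sref !negbK f1 f2.
  rewrite (step a' [:: j', i' & c]) // ?(wperm_cons, cE, srefKl) //.
  rewrite (step b' [:: i', j' & c]) // ?(wperm_cons, cE', srefKl) //.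
  by rewrite /tw !big_cons !mulrA tB.
have sb : (size b <= size a)%N by rewrite sE.
have [ltij|leji] := ltnP i j.
  have [|le] := ltnP i.+1 j; first by move/comm; apply.
  by apply: braid => //; apply/eqP; rewrite eqn_leq le.
have ltji : (j < i)%N by rewrite ltn_neqAle leji andbT eq_sym.
have [lt|le] := ltnP j.+1 i; apply/esym; first exact: comm lt _ _ _ _ _ _ _ _.
by apply: braid => //; apply/eqP; rewrite eqn_leq le.
Qed.

Let F h : A := \sum_w hcoef h w *: tw (rword w).

Fact hecke_lift_linear : linear F.
Proof.
move=> c h k; rewrite /F scaler_sumr -big_split; apply: eq_bigr => w _.
by rewrite hcoefD hcoefZ scalerDl scalerA.
Qed.
HB.instance Definition _ :=
  GRing.isLinear.Build {poly int} (hecke n) A *:%R F hecke_lift_linear.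

Fact hecke_liftT a : reduced a -> F (T (wperm a)) = tw a.
Proof.
move=> ra; rewrite /F (bigD1 (wperm a)) // big1.
  rewrite hcoefT eqxx /= scale1r addr0.
  by apply: matsumoto; rewrite ?rword_reduced ?rwordP.
by move=> w /andP[_ wv]; rewrite hcoefT (negPf wv) scale0r.
Qed.

Fact hecke_lift_lop i h : F (lop i h) = t i * F h.
Proof.
have [_ _ tQ] := tR.
rewrite -mulTs [h]hecke_sumT mulr_sumr !linear_sum mulr_sumr.
apply: eq_bigr => w _; rewrite -scalerAr !linearZ_LR -scalerAr; congr (_ *: _).
have FE x y : F (x + 'X *: y) = F x + 'X *: F y by rewrite linearD linearZ_LR.
change (F (T (sref i) * T w) = t i * F (T w)).
rewrite mulTsT; have [d|nd] := boolP (ldes i w).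
  pose c := rword (sref i * w)%g.
  have cE : wperm c = (sref i * w)%g by apply: rwordP.
  have rc : reduced c by apply: rword_reduced.
  have ric : reduced (i :: c) by rewrite reduced_ldes rc cE ldes_sref negbK.
  have wE : w = wperm (i :: c) by rewrite wperm_cons cE srefKl.
  rewrite FE -cE {1 2}wE !hecke_liftT //.
  by rewrite /tw big_cons mulrA tQ mulrDl mul1r -scalerAl.
have rc : reduced (i :: rword w).
  by rewrite reduced_ldes rword_reduced rwordP.
rewrite -{1}(rwordP w) -wperm_cons hecke_liftT // -[in RHS](rwordP w).
by rewrite hecke_liftT ?rword_reduced // /tw big_cons.
Qed.

Fact hecke_lift_monoid : monoid_morphism F.
Proof.
split=> [|h k].
  rewrite hecke1E -(wperm_nil n) hecke_liftT /tw ?big_nil //.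
  by rewrite /reduced wperm_nil ell1.
rewrite [h]hecke_sumT mulr_suml !linear_sum mulr_suml.
apply: eq_bigr => w _; rewrite -scalerAl !linearZ_LR -scalerAl.
congr (_ *: _); change (F (T w * k) = F (T w) * F k).
rewrite -(rwordP w) hecke_liftT ?rword_reduced //.
rewrite T_reduced ?rword_reduced //.
elim: (rword w) => [|i a IH]; first by rewrite /tw !big_nil !mul1r.
by rewrite /tw !big_cons -!mulrA mulTs hecke_lift_lop IH.
Qed.
HB.instance Definition _ :=
  GRing.isMonoidMorphism.Build (hecke n) A F hecke_lift_monoid.

Lemma hecke_lift_ex : exists f : {lrmorphism hecke n -> A},
  forall i, f (T (sref i)) = t i.
Proof.
exists F => i; have [_ _ tQ] := tR.
by rewrite -[T _]mulr1 mulTs /= hecke_lift_lop rmorph1 mulr1.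
Qed.

End Universal.

(* [hecke n] is the algebra with generators T_s, s simple, subject to the      *)
(* relations [hecke_relations]: these hold by [hecke_relationsT], and every    *)
(* solution of them in an algebra extends uniquely to an algebra morphism.     *)
Theorem hecke_universal (A : algType {poly int}) (t : 'I_n.-1 -> A) :
  hecke_relations t ->
  exists f : {lrmorphism hecke n -> A},
    (forall i, f (T (sref i)) = t i) /\
    (forall g : {lrmorphism hecke n -> A},
       (forall i, g (T (sref i)) = t i) -> g =1 f).
Proof.
move=> /hecke_lift_ex[f fE]; exists f; split=> // g gE h.
rewrite [h]hecke_sumT !linear_sum; apply: eq_bigr => w _.
rewrite !linearZ_LR; congr (_ *: _); rewrite -(rwordP w).
rewrite T_reduced ?rword_reduced // !rmorph_prod.
by apply: eq_bigr => i _; apply: etrans (gE i) (esym (fE i)).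
Qed.

End HeckePresentation.

Section Form.
Variable n : nat.
Implicit Types (g h : hecke n).

Definition hform g h : {poly int} := \sum_w hcoef g w * hcoef h w.

Lemma hform_linearl h : linear (hform^~ h : hecke n -> {poly int}^o).
Proof.
move=> a g k; rewrite /hform scaler_sumr -big_split; apply: eq_bigr => w _.
by rewrite hcoefD hcoefZ mulrDl -mulrA.
Qed.

Lemma hform_linearr g : linear (hform g : hecke n -> {poly int}^o).
Proof.
move=> a h k; rewrite /hform scaler_sumr -big_split; apply: eq_bigr => w _.
by rewrite hcoefD hcoefZ mulrDr mulrCA.
Qed.

Lemma hformT u v : hform (T u) (T v) = (u == v)%:R.
Proof.
rewrite /hform (bigD1 u) // big1 => [|w /andP[_ wu]].
  by rewrite !hcoefT eqxx /= addr0 mul1r.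
by rewrite !hcoefT (negPf wu) mul0r.
Qed.

Definition hnorm h : hecke n := \sum_(d : 'S_n) T d^-1 * h * T d.

Definition central h : Prop := forall k, GRing.comm h k.

End Form.

Definition is_partition (n : nat) (l : seq nat) : bool :=
  [&& sorted geq l, 0%N \notin l & sumn l == n].

Record intpart (n : nat) : Type :=
  IntPart { parts :> seq nat; _ : is_partition n parts }.

Section Partitions.
Variable n : nat.
Implicit Types (lam : intpart n) (w : 'S_n).

HB.instance Definition _ := [isSub for @parts n].
HB.instance Definition _ := [Countable of intpart n by <:].

Fact size_parts lam : (size lam <= n)%N.
Proof.
case: lam => l /= /and3P[_ + /eqP <-]; elim: l => //= x l IH.
by rewrite inE negb_or eq_sym -lt0n => /andP[x0 /IH]; lia.
Qed.

Fact parts_le lam x : x \in parts lam -> (x <= n)%N.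
Proof.
case: lam => l /= /and3P[_ _ /eqP <-]; elim: l => //= y l IH.
by rewrite inE => /predU1P[->|/IH]; lia.
Qed.

Fact partn_code_subproof lam : (size [seq inord x : 'I_n.+1 | x <- lam] <= n)%N.
Proof. by rewrite size_map size_parts. Qed.

Let code lam : n.-bseq 'I_n.+1 := Bseq (partn_code_subproof lam).
Let decode (s : n.-bseq 'I_n.+1) : option (intpart n) := insub [seq val x | x <- s].

Fact partn_codeK : pcancel code decode.
Proof.
move=> lam; rewrite /decode /= -map_comp.
have -> : [seq (val \o (inord : nat -> 'I_n.+1)) x | x <- lam] = parts lam.
  rewrite -[RHS]map_id; apply/eq_in_map => x /parts_le le_x.
  by apply: (@inordK n x); rewrite ltnS.
exact: valK.
Qed.

HB.instance Definition _ : isFinite (intpart n) := PCanIsFinite partn_codeK.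

(* [in_block lam r k]: sref k is one of the generators of the r-th factor of   *)
(* S_lam (r and k counted from 0); that factor permutes the points             *)
(* psum lam r, ..., psum lam r.+1 - 1.                                         *)
Definition psum (l : seq nat) (r : nat) : nat := sumn (take r l).
Definition in_block (l : seq nat) (r k : nat) : bool :=
  (psum l r <= k)%N && (k.+1 < psum l r.+1)%N.

Definition young_factor lam (r : nat) : {group 'S_n} :=
  <<[set sref i | i : 'I_n.-1 & in_block lam r i]>>%G.

Definition young_subgroup lam : {group 'S_n} :=
  (\prod_(r < size lam) young_factor lam r)%G.

Definition w_part lam : 'S_n :=
  (\prod_(r < size lam) \prod_(i < n.-1 | in_block lam r i) sref i)%g.

Definition cycle_type w : seq nat :=
  sort geq [seq #|X| | X : {set 'I_n} <- enum (porbits w)].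

Definition cclass lam : {set 'S_n} := [set w | cycle_type w == parts lam].

Definition min_in_class w : bool :=
  [forall v in (w ^: [set: 'S_n])%g, (ell w <= ell v)%N].

(* The group algebra Z S_n, as a Z-module: {ffun 'S_n -> int}.                 *)
Definition gbasis w : {ffun 'S_n -> int} := [ffun v => (v == w)%:R].

Definition specialize0 (h : hecke n) : {ffun 'S_n -> int} :=
  [ffun w => (hcoef h w).[0]].

(* The Geck-Rouquier characterization of the class elements.                   *)
Record class_elements (Gamma : intpart n -> hecke n) : Prop := ClassElements {
  class_central : forall lam, central (Gamma lam);
  class_specialize : forall lam,
    specialize0 (Gamma lam) = \sum_(w in cclass lam) gbasis w;
  class_min_length : forall lam w, min_in_class w ->
    hcoef (Gamma lam - \sum_(v in cclass lam) T v) w = 0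
}.

End Partitions.

(* Main.v *)
(** For the symmetric trace form tau h = hcoef h 1 the families (T_d) and
    (T_(d^-1)) are dual bases. Hence N = hnorm 1 is central, and its
    coefficient at w is the trace of the multiplication by T_(w^-1), that is
    the sum over d of the coefficient of T_d in T_(w^-1) T_d. When w is a
    product of r distinct simple reflections, forming a set J, the only walk
    from d back to d is the constant one, which contributes 'X^r when all of J
    are descents of d, and nothing otherwise. There is exactly one such d in
    each coset of the parabolic subgroup W_J: its longest element.

    For the expansion in the class elements no reduction of elements to minimal
    length is needed. [Gamma mu] has coefficient delta at [w_part lam], which
    is of minimal length in its class, so it suffices that a central f vanishing
    at all [w_part lam] is zero. At 'X = 0 such an f is a class function, and
    every class contains some [w_part lam], so f is divisible by 'X; the
    quotient is again central and vanishes at all [w_part lam], and one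
    iterates. *)

Require Import Defs.
From mathcomp Require Import all_boot all_order all_fingroup all_algebra.
From mathcomp Require Import zify ring.

Set Implicit Arguments.
Unset Strict Implicit.
Unset Printing Implicit Defensive.

Import GRing.Theory.
Local Open Scope ring_scope.

(** * The trace form and the norm of the identity *)

Section TraceForm.
Variable n : nat.
Implicit Types (g h : hecke n) (w u v : 'S_n) (i : 'I_n.-1) (a : seq 'I_n.-1).

Lemma wperm_rev a : wperm (rev a) = (wperm a)^-1%g.
Proof.
elim: a => [|i a IH]; first by rewrite wperm_nil invg1.
by rewrite rev_cons -cats1 wperm_cat !wperm_cons wperm_nil mulg1 IH invMg srefV.
Qed.

Lemma mulT_wperm a h : reduced a -> T (wperm a) * h = foldr (@lop n) h a.
Proof.
move=> ra; rewrite T_reduced //; elim: a {ra} => [|i a IH] /=.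
  by rewrite big_nil mul1r.
by rewrite big_cons -mulrA IH mulTs.
Qed.

Lemma mulrTs i h : h * T (sref i) = rop i h.
Proof.
have -> : T (sref i) = rop i 1 :> hecke n.
  by rewrite hecke1E ropT mul1g invg1 -ell_ldes ell1 ltn0 scale0r addr0.
exact: etrans (hecke_mul_rop i h 1) (congr1 (rop i) (mulr1 h)).
Qed.

Lemma hformTr h w : hform h (T w) = hcoef h w.
Proof.
rewrite /hform (bigD1 w) // big1 => [|v /andP[_ /negPf vw]].
  by rewrite hcoefT eqxx /= addr0 mulr1.
by rewrite hcoefT vw mulr0.
Qed.

(** Translation by the involution [sref i] is self-adjoint, by reindexing, and the other term of
    [lop i] is diagonal. *)
Lemma hform_lop i g h : hform (lop i g) h = hform g (lop i h).
Proof.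
rewrite /hform; under eq_bigr do rewrite lopE mulrDl.
under [RHS]eq_bigr do rewrite lopE mulrDr.
rewrite !big_split /=; congr (_ + _); last by apply: eq_bigr => w _; ring.
rewrite (reindex_inj (mulgI (sref i))) /=.
by apply: eq_bigr => w _; rewrite srefKl.
Qed.

(** Each letter of a reduced word moves across the form by [hform_lop], which reverses the word. *)
Lemma hform_mulT w g h : hform (T w * g) h = hform g (T w^-1%g * h).
Proof.
have rw := rword_reduced w.
have rV : reduced (rev (rword w)).
  by rewrite /reduced size_rev wperm_rev ellV rwordP size_rword.
have wVE : w^-1%g = wperm (rev (rword w)) by rewrite wperm_rev rwordP.
rewrite wVE mulT_wperm // -[in LHS](rwordP w) mulT_wperm //.
elim: (rword w) h => //= i a IH h.
by rewrite hform_lop IH rev_cons foldr_rcons.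
Qed.

Lemma hcoef_mulTl w h : hcoef (T w^-1%g * h) 1%g = hcoef h w.
Proof. by rewrite -hformTr hform_mulT invgK -hecke1E mulr1 hformTr. Qed.

Lemma hcoef_mulTr w h : hcoef (h * T w^-1%g) 1%g = hcoef h w.
Proof.
rewrite [h]hecke_sumT mulr_suml !hcoef_sum; apply: eq_bigr => u _.
rewrite -scalerAl !hcoefZ -[X in T X * _]invgK hcoef_mulTl !hcoefT.
by rewrite (inj_eq invg_inj) eq_sym.
Qed.

Lemma hcoef1_mulC g h : hcoef (g * h) 1%g = hcoef (h * g) 1%g.
Proof.
rewrite [g]hecke_sumT mulr_suml mulr_sumr !hcoef_sum; apply: eq_bigr => w _.
by rewrite -scalerAl -scalerAr !hcoefZ -[X in T X]invgK hcoef_mulTl hcoef_mulTr.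
Qed.

Lemma hnorm1_central : central (hnorm (T 1%g : hecke n)).
Proof.
move=> h; rewrite /hnorm /GRing.comm -hecke1E mulr_suml mulr_sumr.
(* By duality and symmetry of the trace, right multiplication by [h] on the [T d] and left
   multiplication on the [T d^-1] have transposed matrices, so the two double sums agree after an
   exchange. *)
pose c d e := hcoef (h * T d^-1%g * T e) 1%g.
have mulTh d : T d * h = \sum_e c e d *: T e.
  rewrite [LHS]hecke_sumT; apply: eq_bigr => e _; congr (_ *: _).
  by rewrite -hcoef_mulTr -mulrA hcoef1_mulC.
have mulhT d : h * T d^-1%g = \sum_e c d e *: T e^-1%g.
  rewrite [LHS]hecke_sumT (reindex_inj invg_inj); apply: eq_bigr => e _.
  by congr (_ *: _); rewrite -hcoef_mulTr invgK.
under eq_bigr do rewrite mulr1 -mulrA mulTh mulr_sumr.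
under [RHS]eq_bigr do rewrite mulr1 mulrA mulhT mulr_suml.
rewrite exchange_big; apply: eq_bigr => d _; apply: eq_bigr => e _.
by rewrite -scalerAr -scalerAl.
Qed.

Lemma hcoef_hnorm1 w :
  hcoef (hnorm (T 1%g)) w = \sum_d hcoef (T w^-1%g * T d) d.
Proof.
rewrite /hnorm -hecke1E hcoef_sum (reindex_inj invg_inj).
apply: eq_bigr => d _; rewrite mulr1 invgK -hcoef_mulTl mulrA.
by rewrite hcoef_mulTr.
Qed.

End TraceForm.

(** * Parabolic subgroups and words with distinct letters *)

Section Parabolic.
Variable n : nat.
Implicit Types (g w u v d : 'S_n) (i : 'I_n.-1) (a : seq 'I_n.-1).
Implicit Types (J : {set 'I_n.-1}).

Definition parabolic J : {group 'S_n} := <<[set sref i | i in J]>>%G.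

(* The blocks of J are the fibers of [block J]: maximal intervals of points    *)
(* linked by the generators in J.                                              *)
Definition block J (x : nat) : nat := #|[set i | (i \notin J) && (i < x)%N]|.

Lemma block_mono J : {homo block J : x y / (x <= y)%N}.
Proof.
move=> x y xy; apply/subset_leq_card/subsetP => i; rewrite !inE.
by case/andP=> -> /leq_trans->.
Qed.

Lemma blockS J i : block J i.+1 = (block J i + (i \notin J))%N.
Proof.
rewrite /block (cardsD1 i) inE ltnSn andbT addnC; congr (_ + _)%N.
apply: eq_card => k; rewrite !inE ltnS (leq_eqVlt k) -val_eqE.
by case: (ltngtP k i); rewrite ?andbF ?andbT.
Qed.

(** Monotonicity forces [block J i] and [block J i.+1] to agree, so [i] does not open a new
    block. *)
Lemma block_eq J i (x y : nat) :
  block J x = block J y -> (x <= i < y)%N -> i \in J.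
Proof.
move=> E /andP[xi iy]; have := block_mono J xi; have := block_mono J iy.
by rewrite blockS E; case: (i \in J) => //; lia.
Qed.

Lemma block_sref J i (x : 'I_n) : i \in J -> block J (sref i x) = block J x.
Proof.
move=> iJ; have := blockS J i; rewrite iJ addn0 srefE /tr => E.
by case: eqP => [->|_] //; case: eqP => [->|].
Qed.

Lemma block_parabolic J g (x : 'I_n) :
  g \in parabolic J -> block J (g x) = block J x.
Proof.
case/gen_prodgP=> m [c cJ ->]; move: x.
elim/big_ind: _ => [x|u v IHu IHv x|k _ x]; first by rewrite perm1.
  by rewrite permM IHv IHu.
by have /imsetP[i iJ ->] := cJ k; apply: block_sref.
Qed.

Lemma sref_parabolic J i : (sref i \in parabolic J) = (i \in J).
Proof.
apply/idP/idP => [/(@block_parabolic _ _ (sref_lo i))|iJ]; last exact/mem_gen/imset_f.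
by rewrite sref_lohi blockS; case: (i \in J) => //=; lia.
Qed.

(** Blocks are preserved, and the two points moved by [sref i] lie in successive blocks. *)
Lemma parabolic_ldes J i g : g \in parabolic J -> i \notin J -> ~~ ldes i g.
Proof.
move=> gJ iJ; rewrite /ldes -leqNgt leqNgt; apply/negP => /ltnW/(block_mono J).
by rewrite !block_parabolic //= blockS iJ; lia.
Qed.

(** The longest elements of the right cosets of [parabolic J], described by descents. *)
Definition full_des J : {set 'S_n} := [set d | [forall (i | i \in J), ldes i d]].

Lemma full_desP J d :
  reflect {in J, forall i, ldes i d} (d \in full_des J).
Proof. by rewrite inE; apply: forall_inP. Qed.

(** Neighbouring points of a block are linked by a generator in [J], so the descents chain
    together. *)
Lemma full_des_block J d (x y : 'I_n) :
  d \in full_des J -> block J x = block J y -> (x < y)%N -> (d y < d x)%N.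
Proof.
move/full_desP=> dJ; case: y => y; elim: y x => [//|y IHy] x yn /= E xy.
have yn1 : (y < n.-1)%N by lia.
have step : (d (Ordinal yn) < d (Ordinal (ltnW yn)))%N.
  have := dJ (Ordinal yn1); rewrite /ldes.
  have -> : sref_lo (Ordinal yn1) = Ordinal (ltnW yn) by apply: val_inj.
  have -> : sref_hi (Ordinal yn1) = Ordinal yn by apply: val_inj.
  by apply; apply: (block_eq E) => /=; lia.
have [->|ne] := eqVneq x (Ordinal (ltnW yn)); first exact: step.
have xy' : (x < y)%N by move: ne; rewrite -val_eqE /=; lia.
apply: ltn_trans step _; apply: IHy => //=.
have := block_mono J (ltnW xy'); have := block_mono J (leqnSn y); lia.
Qed.

(** A descent of [g] would lie in [J]; since [d] reverses the order within a block, it would become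
    an ascent of [g * d]. So [g] has no descent. *)
Lemma full_des_uniq J g d :
  g \in parabolic J -> d \in full_des J -> (g * d)%g \in full_des J -> g = 1%g.
Proof.
move=> gJ dJ /full_desP gdJ; apply: no_ldes => i.
have [iJ|/(parabolic_ldes gJ)//] := boolP (i \in J).
apply/negP => lt_g; have := gdJ i iJ; rewrite /ldes !permM ltnNge => /negP; apply.
apply/ltnW/(full_des_block dJ) => //.
by rewrite !block_parabolic //= blockS iJ addn0.
Qed.

(** An element of maximal length works: a missing descent would yield a longer element of the same
    coset. *)
Lemma full_des_ex J w : exists2 d, d \in full_des J & d \in (parabolic J :* w)%g.
Proof.
case: (@arg_maxnP _ w [in parabolic J :* w]%g (@ell n) (rcoset_refl _ w)).
move=> d dw dmax; exists d => //; apply/full_desP => i iJ.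
apply: contraT => nd; have := dmax (sref i * d)%g; rewrite /geq /= ell_up // ltnn.
apply; move: dw; rewrite /= !mem_rcoset -mulgA => dw.
by rewrite groupMl //; apply/mem_gen/imset_f.
Qed.

Lemma card_full_des J : #|full_des J| = #|[set: 'S_n] : parabolic J|%g.
Proof.
rewrite /indexg; have inj : {in full_des J &, injective (rcoset (parabolic J))}.
  move=> d e dJ eJ E; have deJ : (d * e^-1)%g \in parabolic J.
    by rewrite -mem_rcoset -rcosetE -E rcosetE rcoset_refl.
  apply/eqP; rewrite eq_mulgV1; apply/eqP.
  by apply: (full_des_uniq deJ eJ); rewrite mulgKV.
rewrite -(card_in_imset inj); apply: eq_card => A; apply/imsetP/imsetP.
  by case=> d _ ->; exists d.
case=> w _ ->; have [d dJ /rcoset_eqP dw] := full_des_ex J w.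
by exists d; rewrite ?rcosetE.
Qed.

Lemma wperm_parabolic J a : {subset a <= J} -> wperm a \in parabolic J.
Proof.
by move=> aJ; rewrite /wperm big_seq group_prod // => i /aJ; rewrite sref_parabolic.
Qed.

(** The tail lies in a parabolic subgroup generated without the head letter, which is therefore not
    a descent of it. *)
Lemma uniq_reduced a : uniq a -> reduced a.
Proof.
elim: a => [_|i a IH /= /andP[ia /IH ra]]; first by rewrite /reduced wperm_nil ell1.
rewrite reduced_ldes ra; apply: (@parabolic_ldes [set k in a]); last by rewrite inE.
by apply: wperm_parabolic => k; rewrite inE.
Qed.

(** The operators [lop i] with [i] in [J] keep the support inside the coset of [d]. *)
Lemma hcoef_fold_support J a d w : {subset a <= J} -> (w * d^-1)%g \notin parabolic J ->
  hcoef (foldr (@lop n) (T d) a) w = 0.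
Proof.
elim: a w => [|i a IH] w aJ wd.
  rewrite hcoefT; case: eqP wd => // ->.
  by rewrite mulgV group1.
have iJ : sref i \in parabolic J by rewrite sref_parabolic aJ ?mem_head.
have {}aJ : {subset a <= J} by move=> k ka; rewrite aJ // inE ka orbT.
by rewrite lopE !IH // ?mulr0 ?addr0 // -mulgA groupMl.
Qed.

Lemma hcoef_fold_uniq a d : uniq a ->
  hcoef (foldr (@lop n) (T d) a) d = (d \in full_des [set i in a])%:R * 'X^(size a).
Proof.
have -> : d \in full_des [set i in a] = all (fun i => ldes i d) a.
  apply/full_desP/allP => h i; first by move=> ia; apply: h; rewrite inE.
  by rewrite inE; apply: h.
elim: a => [_|i a IH /= /andP[ia ua]]; first by rewrite /= hcoefT eqxx mulr1.
(* The off-diagonal term vanishes: returning to [d] would put [sref i] in the parabolic subgroup of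
   the remaining letters. *)
rewrite lopE IH // (@hcoef_fold_support [set k in a]).
- rewrite add0r exprS; case: ldes; case: all => /=; ring.
- by move=> k; rewrite inE.
by rewrite mulgK sref_parabolic inE.
Qed.

Lemma hcoef_hnorm1_wperm a : uniq a ->
  hcoef (hnorm (T 1%g)) (wperm a)
    = #|[set: 'S_n] : parabolic [set i in a]|%g%:R * 'X^(size a).
Proof.
move=> ua; have ur : uniq (rev a) by rewrite rev_uniq.
rewrite hcoef_hnorm1 -wperm_rev -card_full_des.
transitivity (\sum_(d in full_des [set i in a]) 'X^(size a) : {poly int}).
  rewrite [RHS]big_mkcond; apply: eq_bigr => d _.
  rewrite mulT_wperm ?uniq_reduced // hcoef_fold_uniq // size_rev.
  have -> : [set i in rev a] = [set i in a] by apply/setP => i; rewrite !inE mem_rev.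
  by case: ifP; rewrite ?mul1r ?mul0r.
by rewrite sumr_const mulr_natl.
Qed.

End Parabolic.

(** * Conjugacy of permutations through their orbits *)

Section Conjugacy.
Variable U : finType.
Implicit Types (s t u v g : {perm U}) (x y : U).

Lemma porbit_expgE s x i j :
  ((s ^+ i)%g x == (s ^+ j)%g x) = (i == j %[mod #|porbit s x|]).
Proof.
set m := #|porbit s x|; have m_gt0 : (0 < m)%N by rewrite lt0n card_porbit_neq0.
have per k q : (s ^+ (q * m))%g ((s ^+ k)%g x) = (s ^+ k)%g x.
  elim: q => [|q IH]; first by rewrite perm1.
  by rewrite mulSn expgD permM [(s ^+ m)%g _]permX /m -(porbit_perm s k) iter_porbit
    porbit_perm.
have modE k : (s ^+ k)%g x = nth x (traject s x m) (k %% m).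
  by rewrite nth_traject ?ltn_mod // -permX {1}(divn_eq k m) addnC expgD permM per.
by rewrite !modE nth_uniq ?size_traject ?ltn_mod ?uniq_traject_porbit.
Qed.

(** The conjugating element sends the k-th iterate of a chosen point of an orbit [X] to the k-th
    iterate of a chosen point of [phi X]. *)
Lemma conj_porbits u v (phi : {set U} -> {set U}) :
    {in porbits u, forall X, phi X \in porbits v} ->
    {in porbits u, forall X : {set U}, #|phi X| = #|X|} ->
    {in porbits u &, injective phi} ->
  exists g, v = (u ^ g)%g.
Proof.
move=> phiP phi_card phi_inj.
(* Choosing representatives needs a default value [x0], so the empty type is treated apart. *)
have [x0 _|U0] := pickP U; last by exists 1%g; apply/permP => x; have := U0 x.
pose rep (X : {set U}) := odflt x0 [pick y in X].
have repP s X : X \in porbits s -> porbit s (rep X) = X.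
  case/imsetP=> x _ ->; rewrite /rep; case: pickP => [y|/(_ x)].
    by rewrite -eq_porbit_mem => /eqP.
  by rewrite porbit_id.
have mem_orb s x : porbit s x \in porbits s by apply: imset_f.
have kP x : exists k, x == (u ^+ k)%g (rep (porbit u x)).
  have /porbitP[k E] : x \in porbit u (rep (porbit u x)) by rewrite repP ?porbit_id.
  by exists k; apply/eqP.
pose k x := xchoose (kP x).
have kE x : (u ^+ k x)%g (rep (porbit u x)) = x by apply/esym/eqP/(xchooseP (kP x)).
pose f x := (v ^+ k x)%g (rep (phi (porbit u x))).
(* Equal orbit sizes make iterates coincide for the same exponents on both sides, so the choice of
   [k x] does not matter. *)
have eq_pow i j x : (u ^+ i)%g (rep (porbit u x)) = (u ^+ j)%g (rep (porbit u x))
    <-> (v ^+ i)%g (rep (phi (porbit u x))) = (v ^+ j)%g (rep (phi (porbit u x))).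
  by split=> /eqP; rewrite porbit_expgE => h; apply/eqP; rewrite porbit_expgE;
    move: h; rewrite !repP ?phi_card // phiP.
have f_inj : injective f.
  move=> x y fxy; have E : porbit u x = porbit u y.
    apply: phi_inj => //; rewrite -(repP v (phi _)) ?phiP //.
    rewrite -[RHS](repP v) ?phiP //.
    by rewrite -(porbit_perm v (k x)) -[RHS](porbit_perm v (k y)) -/(f x) fxy.
  rewrite -(kE x) -(kE y) -E; apply/eq_pow.
  by move: fxy; rewrite /f -E.
have fM x : f (u x) = v (f x).
  have E : porbit u (u x) = porbit u x by rewrite -(porbit_perm u 1 x) expg1.
  rewrite /f E -permM -expgSr; apply/eq_pow.
  by rewrite expgSr permM kE -E kE.
exists (perm f_inj); apply/permP => y; rewrite -[y](permKV (perm f_inj)).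
by rewrite permJ !permE fM.
Qed.

Lemma porbitJ s g x : porbit (s ^ g)%g (g x) = g @: porbit s x.
Proof.
apply/setP => y; apply/porbitP/imsetP => [[i ->]|[z /porbitP[i ->] ->]].
  by exists ((s ^+ i)%g x); rewrite ?mem_porbit // -conjXg permJ.
by exists i; rewrite -conjXg permJ.
Qed.

Lemma card_porbitsJ s g : #|porbits (s ^ g)%g| = #|porbits s|.
Proof.
rewrite -(card_imset (porbits s) (imset_inj (@perm_inj _ g))).
apply: eq_card => X; apply/imsetP/imsetP => [[x _ ->]|[_ /imsetP[x _ ->] ->]].
  exists (porbit s (g^-1%g x)); first exact: imset_f.
  by rewrite -porbitJ permKV.
by exists (g x); rewrite ?porbitJ.
Qed.

Lemma card_porbits1 : #|porbits (1%g : {perm U})| = #|U|.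
Proof.
have orb1 x : porbit 1%g x = [set x].
  apply/setP => y; rewrite inE; apply/porbitP/eqP => [[i ->]|->].
    by rewrite expg1n perm1.
  by exists 0%N; rewrite expg0 perm1.
by apply: card_imset => x y; rewrite !orb1 => /set1_inj.
Qed.

Lemma sum_card_porbits s : (\sum_(X in porbits s) #|X|)%N = #|U|.
Proof.
rewrite -sum1_card (partition_big (porbit s) [in porbits s]) => [|x _]; last first.
  exact: imset_f.
apply: eq_bigr => _ /imsetP[x _ ->]; rewrite sum1_card; apply: eq_card => y.
by rewrite -eq_porbit_mem unfold_in.
Qed.

End Conjugacy.

(** * Cycle types and minimal length in a class *)

Section CycleType.
Variable n : nat.
Implicit Types (w u v : 'S_n) (i : 'I_n.-1) (a : seq 'I_n.-1).

(** Sorting the orbits by size pairs those at equal positions, which provides the map for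
    [conj_porbits]. *)
Lemma cycle_type_conj u v : cycle_type u = cycle_type v -> exists g, v = (u ^ g)%g.
Proof.
rewrite /cycle_type !sort_map.
set s1 := sort _ (enum (porbits u)); set s2 := sort _ (enum (porbits v)) => E.
have m1 : s1 =i porbits u by move=> X; rewrite mem_sort mem_enum.
have m2 : s2 =i porbits v by move=> X; rewrite mem_sort mem_enum.
have sE : size s1 = size s2 by have := congr1 size E; rewrite !size_map.
have u2 : uniq s2 by rewrite sort_uniq enum_uniq.
have i1 X : X \in porbits u -> (index X s1 < size s2)%N.
  by rewrite -m1 -index_mem sE.
apply: (@conj_porbits _ _ _ (fun X => nth set0 s2 (index X s1))) => [X Xu|X Xu|X Y Xu Yu].
- by rewrite -m2 mem_nth ?i1.
- have := congr1 (nth 0%N ^~ (index X s1)) E.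
  rewrite !(nth_map set0) ?sE ?i1 // nth_index ?m1 //; exact: esym.
move/eqP; rewrite nth_uniq ?i1 // => /eqP /(congr1 (nth set0 s1)).
by rewrite !nth_index ?m1.
Qed.

Lemma cycle_type_partition w : is_partition n (cycle_type w).
Proof.
apply/and3P; split.
- by apply: sort_sorted => x y; apply: leq_total.
- rewrite mem_sort; apply/mapP => -[X]; rewrite mem_enum => /imsetP[x _ ->] /esym/eqP.
  by rewrite (negPf (card_porbit_neq0 w x)).
rewrite /cycle_type (perm_sumn (permEl (perm_sort _ _))) sumnE big_map big_enum.
by rewrite sum_card_porbits card_ord.
Qed.

Lemma porbits_sref i w :
  (#|porbits (sref i * w)| + (sref_lo i \notin porbit w (sref_hi i)).*2 =
   #|porbits w|.+1)%N.
Proof.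
rewrite porbits_mul_tperm -val_eqE /=.
by rewrite (_ : (i == i.+1 :> nat) = false) ?addn1 //; lia.
Qed.

(** The identity has [n] orbits, and each generator lowers their number by at most one. *)
Lemma leq_ell_porbits w : (n <= ell w + #|porbits w|)%N.
Proof.
rewrite -size_rword -[in porbits w](rwordP w); elim: (rword w) => [|i a IH].
  by rewrite wperm_nil card_porbits1 card_ord.
move: (porbits_sref i (wperm a)) IH; rewrite wperm_cons /=.
case: (_ \notin _) => /=; lia.
Qed.

(** Each letter merges two orbits: the letters after it preserve blocks, and its two points lie in
    different blocks. *)
Lemma ell_porbits_uniq a :
  uniq a -> (ell (wperm a) + #|porbits (wperm a)| = n)%N.
Proof.
move=> ua; have /eqP <- := uniq_reduced ua.
elim: a ua => [_|i a IH /= /andP[ia /IH {}IH]].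
  by rewrite wperm_nil card_porbits1 card_ord.
have := porbits_sref i (wperm a); rewrite wperm_cons.
suff -> : sref_lo i \notin porbit (wperm a) (sref_hi i) by move: IH => /=; lia.
apply/porbitP => -[m]; pose J := [set k in a].
have aJ : (wperm a ^+ m)%g \in parabolic J.
  by rewrite groupX // wperm_parabolic // => k; rewrite inE.
move/(congr1 (fun x : 'I_n => block J x)); rewrite block_parabolic //= blockS inE ia.
lia.
Qed.

(** The number of orbits is a class invariant, so the bound [leq_ell_porbits] is the same throughout
    the class, and it is attained here. *)
Lemma min_in_class_uniq a : uniq a -> min_in_class (wperm a).
Proof.
move=> ua; apply/forall_inP => _ /imsetP[g _ ->].
rewrite -(leq_add2r #|porbits (wperm a)|) ell_porbits_uniq //.
by rewrite -(card_porbitsJ (wperm a) g); apply: leq_ell_porbits.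
Qed.

End CycleType.

(** * The increasing word and the orbits of [w_part lam] *)

Section PartitionWord.
Variables (n : nat) (lam : intpart n).
Implicit Types (i : 'I_n.-1) (a : seq 'I_n.-1) (x y : 'I_n) (r m : nat).

Lemma intpartP : [/\ sorted geq lam, 0%N \notin parts lam & sumn lam = n].
Proof. by case: lam => l /= /and3P[? ? /eqP]. Qed.

Lemma psumS r : psum lam r.+1 = (psum lam r + nth 0 lam r)%N.
Proof.
rewrite /psum; have [lt_r|le_r] := ltnP r (size lam).
  by rewrite (take_nth 0%N) // sumn_rcons.
by rewrite !take_oversize ?nth_default ?addn0 // leqW.
Qed.

Lemma psum_mono : {homo psum lam : r m / (r <= m)%N}.
Proof.
by apply: homo_leq => [//|r m p|r]; [apply: leq_trans | rewrite psumS leq_addr].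
Qed.

Lemma psum_size : psum lam (size lam) = n.
Proof. by rewrite /psum take_size; have [] := intpartP. Qed.

Lemma psum_ltS r : (r < size lam)%N -> (psum lam r < psum lam r.+1)%N.
Proof.
move=> lt_r; rewrite psumS -addn1 leq_add2l lt0n.
by have [_ + _] := intpartP; apply: contraNneq => <-; apply: mem_nth.
Qed.

Lemma psum_le r : (r <= size lam)%N -> (psum lam r <= n)%N.
Proof. by move/psum_mono; rewrite psum_size. Qed.

Definition block_word r : seq 'I_n.-1 :=
  [seq i : 'I_n.-1 <- enum 'I_n.-1 | in_block lam r i].

Definition part_word m : seq 'I_n.-1 := flatten [seq block_word r | r <- iota 0 m].

Lemma mem_part_word m i :
  reflect (exists2 r, (r < m)%N & in_block lam r i) (i \in part_word m).
Proof.
apply: (iffP flatten_mapP) => -[r].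
  by rewrite mem_iota add0n mem_filter => rm /andP[ri _]; exists r.
by move=> rm ri; exists r; rewrite ?mem_iota // mem_filter ri mem_enum.
Qed.

Lemma part_word_ltn m : pairwise (relpre val ltn) (part_word m).
Proof.
elim: m => // m IH; rewrite /part_word -addn1 iotaD map_cat flatten_cat /= cats0 add0n.
rewrite -/(part_word m) pairwise_cat IH /=; apply/andP; split.
  apply/allrelP => i j /mem_part_word[r rm /andP[_ lt_i]].
  rewrite mem_filter => /andP[/andP[le_j _] _] /=.
  exact: leq_trans (ltnW lt_i) (leq_trans (psum_mono rm) le_j).
apply: pairwise_filter; rewrite -(pairwise_map val ltn) val_enum_ord.
by rewrite -sorted_pairwise ?iota_ltn_sorted //; apply: ltn_trans.
Qed.

Lemma part_word_uniq m : uniq (part_word m).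
Proof.
by apply: pairwise_uniq (part_word_ltn m) => i; rewrite /= ltnn.
Qed.

Lemma w_partE : w_part lam = wperm (part_word (size lam)).
Proof.
rewrite /w_part /wperm big_flatten big_map /= -(big_mkord xpredT
  (fun r => \prod_(i < n.-1 | in_block lam r i) sref i)%g) /index_iota subn0.
by apply: eq_bigr => r _; rewrite big_filter enumT [index_enum _]unlock.
Qed.

Lemma young_subgroupE :
  young_subgroup lam = parabolic [set i in part_word (size lam)] :> {set 'S_n}.
Proof.
rewrite /young_subgroup bigprodGE; apply/eqP; rewrite eqEsubset !gen_subG.
apply/andP; split; apply/subsetP => g.
  case/bigcupP=> r _; move: g; apply/subsetP; rewrite gen_subG.
  apply/subsetP => _ /imsetP[i ri ->]; rewrite sref_parabolic inE.
  by apply/mem_part_word; exists r => //; rewrite inE in ri.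
case/imsetP=> i; rewrite inE => /mem_part_word[r rm ri] ->.
apply/mem_gen/bigcupP; exists (Ordinal rm) => //.
by apply/mem_gen/imset_f; rewrite inE.
Qed.

(** The leftmost letter acts first: letters below [i] fix the upper point of [sref i], then [sref i]
    lowers it, and the later, larger letters fix the result. *)
Lemma wperm_ltn_hi a i :
  pairwise (relpre val ltn) a -> i \in a -> wperm a (sref_hi i) = sref_lo i.
Proof.
elim: a => // j a IH /= /andP[ja aP]; rewrite inE wperm_cons permM.
have [E _|ij /= ia] := eqVneq i j.
  rewrite -{}E sref_hilo in ja *; elim: a ja {IH aP} => [|k a IH] /=.
    by rewrite wperm_nil perm1.
  case/andP=> ik /IH E; rewrite wperm_cons permM -[RHS]E; congr (wperm a _).
  by apply: val_inj; rewrite /= srefE /tr /=; do !case: eqP => //=; lia.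
have := allP ja i ia; rewrite /= => lt_ji.
rewrite (_ : sref j (sref_hi i) = sref_hi i) ?IH //.
by apply: val_inj; rewrite /= srefE /tr /=; do !case: eqP => //=; lia.
Qed.

(** No letter [i] has [i.+1] equal to a boundary [psum lam r], so no generator carries a point
    across one. *)
Lemma leq_psum_w_part r x : (psum lam r <= w_part lam x)%N = (psum lam r <= x)%N.
Proof.
suff key a : {subset a <= part_word (size lam)} ->
    forall x, (psum lam r <= wperm a x)%N = (psum lam r <= x)%N.
  by rewrite w_partE key.
elim: a => [|i a IH] sub {}x; first by rewrite wperm_nil perm1.
rewrite wperm_cons permM IH => [|k ka]; last by rewrite sub // inE ka orbT.
have /mem_part_word[p _ /andP[le_i lt_i]] := sub i (mem_head i a).
have ne : psum lam r <> i.+1.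
  by case: (leqP r p) => /psum_mono; lia.
by rewrite srefE /tr; do !case: eqP => //=; lia.
Qed.

Definition interval_block r : {set 'I_n} :=
  [set x : 'I_n | (psum lam r <= x < psum lam r.+1)%N].

Lemma interval_block_ex x :
  exists2 r, (r < size lam)%N & x \in interval_block r.
Proof.
have : (x < psum lam (size lam))%N by rewrite psum_size.
elim: (size lam) => [|m IH]; first by rewrite /psum take0.
case: (ltnP x (psum lam m)) => [/IH[r rm xr] _|le_x lt_x].
  by exists r => //; apply: ltnW.
by exists m => //; rewrite inE le_x.
Qed.

(** The interval is stable, and each of its points except the first is sent to its predecessor, so
    all lie in the orbit of the first point [p]. *)
Lemma porbit_w_part r x :
  (r < size lam)%N -> x \in interval_block r -> porbit (w_part lam) x = interval_block r.
Proof.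
move=> rm; set w := w_part lam.
have inv k y : ((w ^+ k)%g y \in interval_block r) = (y \in interval_block r).
  elim: k y => [|k IH] y; first by rewrite perm1.
  by rewrite expgS permM IH !inE !leq_psum_w_part !ltnNge !leq_psum_w_part.
have n_gt : (psum lam r < n)%N := leq_trans (psum_ltS rm) (psum_le rm).
pose p := Ordinal n_gt.
have down y : y \in interval_block r -> y \in porbit w p.
  case: y => y; elim: y => [|y IH] yn; rewrite inE /= => /andP[le_y lt_y].
    rewrite (_ : Ordinal yn = p) ?porbit_id //; apply: val_inj => /=; lia.
  move: le_y; rewrite leq_eqVlt => /predU1P[E|le_y].
    by rewrite (_ : Ordinal yn = p) ?porbit_id //; apply: val_inj.
  have yn1 : (y < n.-1)%N by lia.
  have wy : w (Ordinal yn) = Ordinal (ltnW yn).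
    rewrite (_ : Ordinal yn = sref_hi (Ordinal yn1)); last exact: val_inj.
    rewrite /w w_partE wperm_ltn_hi ?part_word_ltn //; first exact: val_inj.
    by apply/mem_part_word; exists r => //; rewrite /in_block /= -ltnS le_y.
  rewrite -eq_porbit_mem -(porbit_perm w 1) expg1 wy eq_porbit_mem.
  by apply: IH; rewrite inE /= -ltnS le_y ltnW.
move=> xr; have/eqP <- : porbit w p == porbit w x by rewrite eq_sym eq_porbit_mem down.
apply/setP => y; apply/idP/idP => [/porbitP[k ->]|/down //].
by rewrite inv inE /= leqnn psum_ltS.
Qed.

Lemma card_interval_block r :
  (r < size lam)%N -> #|interval_block r| = nth 0%N lam r.
Proof.
move=> rm; have := psumS r; have le_n := psum_le rm.
transitivity (psum lam r.+1 - psum lam r)%N; last by lia.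
rewrite -sum1_card -[RHS]muln1 -sum_nat_const_nat (big_nat_widenl _ 0) //.
rewrite (big_nat_widen _ _ n) // big_mkord.
by apply: eq_bigl => x; rewrite inE.
Qed.

Lemma interval_block_inj :
  {in [pred r | r < size lam]%N &, injective interval_block}.
Proof.
move=> r m; rewrite !inE => rs ms E.
have n_gt k : (k < size lam)%N -> (psum lam k < n)%N.
  by move=> ks; apply: leq_trans (psum_ltS ks) (psum_le ks).
have mem k (ks : (k < size lam)%N) : Ordinal (n_gt k ks) \in interval_block k.
  by rewrite inE /= leqnn psum_ltS.
have := mem r rs; rewrite E inE /= => /andP[le1 lt1].
have := mem m ms; rewrite -E inE /= => /andP[le2 lt2].
by case: (ltngtP r m) => // /psum_mono; lia.
Qed.

Lemma porbits_w_part :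
  porbits (w_part lam) = [set interval_block r | r : 'I_(size lam)].
Proof.
apply/setP => X; apply/imsetP/imsetP => [[x _ ->]|[r _ ->]].
  have [r rm xr] := interval_block_ex x.
  by exists (Ordinal rm); rewrite // (porbit_w_part rm).
have /card_gt0P[x xr] : (0 < #|interval_block r|)%N.
  by rewrite card_interval_block //; have := psum_ltS (ltn_ord r); rewrite psumS; lia.
by exists x; rewrite // (porbit_w_part (ltn_ord r)).
Qed.

Lemma cycle_type_w_part : cycle_type (w_part lam) = lam.
Proof.
have [lam_sorted _ _] := intpartP.
have geq_tr : transitive geq by move=> x y z xy yz; apply: leq_trans yz xy.
(* Both sequences are sorted, so only their multisets have to be compared. *)
rewrite -[RHS](sorted_sort geq_tr lam_sorted); apply/perm_sortP => //.
- by move=> x y; apply: leq_total.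
- by move=> x y; rewrite /geq /= -eqn_leq => /eqP->.
rewrite porbits_w_part.
apply: (@perm_trans _ [seq #|interval_block r| | r : 'I_(size lam)]).
  rewrite /image_mem (map_comp (fun X : {set 'I_n} => #|X|)
    (fun r : 'I_(size lam) => interval_block r)).
  apply/perm_map/uniq_perm; rewrite ?enum_uniq //.
    rewrite map_inj_uniq ?enum_uniq // => r m /interval_block_inj E.
    by apply/val_inj/E; rewrite inE.
  move=> X; rewrite mem_enum; apply/imsetP/mapP => -[r _ ->]; exists r => //.
  by rewrite mem_enum.
rewrite -[X in perm_eq _ X](mkseq_nth 0%N) /mkseq -val_enum_ord -map_comp.
suff E : (fun r : 'I_(size lam) => #|interval_block r|) =1 nth 0%N lam \o val.
  by rewrite /image_mem (eq_map E).
by move=> r; apply: card_interval_block.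
Qed.

End PartitionWord.

(** * Central elements and their coefficients at the [w_part mu] *)

Section CentralElements.
Variable n : nat.
Implicit Types (f h : hecke n) (w u v : 'S_n) (i : 'I_n.-1) (lam mu : intpart n).

Lemma central_sum (I : Type) (r : seq I) (c : I -> {poly int}) (F : I -> hecke n) :
  (forall j, central (F j)) -> central (\sum_(j <- r) c j *: F j).
Proof.
move=> Fc k; rewrite /GRing.comm mulr_suml mulr_sumr; apply: eq_bigr => j _.
by rewrite -scalerAl -scalerAr Fc.
Qed.

(** At ['X = 0] the operators [lop i] and [rop i] are plain translations, so commuting with the
    generators gives invariance under conjugation by each [sref i]. *)
Lemma central_eval0_conj f w v :
  central f -> (hcoef f (w ^ v)%g).[0] = (hcoef f w).[0].
Proof.
move=> fc; rewrite -(rwordP v); elim: (rword v) w => [|i a IH] w.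
  by rewrite wperm_nil conjg1.
rewrite wperm_cons conjgM IH.
have := fc (T (sref i)); rewrite /GRing.comm mulTs mulrTs.
(* At [sref i * w] the right product reads the conjugate of [w], and the left product reads [w]
   itself. *)
move/(congr1 (fun h => (hcoef h (sref i * w)%g).[0])).
rewrite ropE lopE !hornerD !hornerM !hornerX !mul0r !mulr0 !addr0 srefKl => <-.
by rewrite /conjg srefV mulgA.
Qed.

Lemma central_eq0 f :
  central f -> (forall mu, hcoef f (w_part mu) = 0) -> f = 0.
Proof.
move=> fc f0.
have dvX k : exists2 h, f = 'X^k *: h &
    central h /\ forall mu, hcoef h (w_part mu) = 0.
  elim: k => [|k [h E [hc h0]]]; first by exists f; rewrite ?expr0 ?scale1r.
  (* [drop_poly 1] is division by ['X], exact here because every constant term vanishes. *)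
  pose g : hecke n := Hecke [ffun w => drop_poly 1 (hcoef h w)].
  have gE : h = 'X *: g.
    apply: heckeP => w; rewrite hcoefZ ffunE.
    apply/polyP => -[|j]; rewrite coefXM ?coef_drop_poly ?addn1 //.
    rewrite -horner_coef0.
    have [v ->] : exists v, w = (w_part (IntPart (cycle_type_partition w)) ^ v)%g.
      by apply: cycle_type_conj; rewrite cycle_type_w_part.
    by rewrite central_eval0_conj // h0 horner0.
  have XI (p q : {poly int}) : 'X * p = 'X * q -> p = q.
    by apply: mulfI; rewrite polyX_eq0.
  exists g; first by rewrite exprSr -scalerA -gE.
  split=> [k'|mu]; last by apply: XI; rewrite mulr0 -hcoefZ -gE h0.
  apply: heckeP => w; apply: XI; rewrite -!hcoefZ scalerAl scalerAr -gE.
  by rewrite hc.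
(* The coefficient of degree [j] vanishes by divisibility by ['X^(j.+1)]. *)
apply: heckeP => w; rewrite hcoef0; apply/polyP => j.
by have [h -> _] := dvX j.+1; rewrite hcoefZ coefXnM ltnSn coef0.
Qed.

End CentralElements.

(** * Coordinates with respect to the class elements *)

Section ClassElements.
Variables (n : nat) (Gamma : intpart n -> hecke n).
Hypothesis GammaP : class_elements Gamma.

(** Minimal length of [w_part lam] in its class makes [Gamma mu] agree there with the sum of the
    [T v] over the class, and the cycle type decides membership. *)
Lemma hcoef_class_element lam mu : hcoef (Gamma mu) (w_part lam) = (lam == mu)%:R.
Proof.
have w_min : min_in_class (w_part lam).
  by rewrite w_partE min_in_class_uniq ?part_word_uniq.
have /eqP := class_min_length GammaP mu w_min.
rewrite hcoefB subr_eq0 => /eqP->; rewrite hcoef_sum.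
have -> : (lam == mu) = (w_part lam \in cclass mu).
  by rewrite inE cycle_type_w_part.
under eq_bigr do rewrite hcoefT.
have [w_mu|w_mu] := boolP (w_part lam \in cclass mu).
  rewrite (bigD1 (w_part lam)) //= eqxx big1 ?addr0 // => v /andP[_ /negPf vw].
  by rewrite eq_sym vw.
by rewrite big1 // => v v_mu; case: eqP w_mu => // ->; rewrite v_mu.
Qed.

(** This recovers the coordinates of any combination, hence their uniqueness. *)
Lemma hcoef_class_sum (c : intpart n -> {poly int}) lam :
  hcoef (\sum_mu c mu *: Gamma mu) (w_part lam) = c lam.
Proof.
rewrite hcoef_sum; under eq_bigr do rewrite hcoefZ hcoef_class_element.
rewrite (bigD1 lam) //= eqxx mulr1 big1 ?addr0 // => mu /negPf ne.
by rewrite eq_sym ne mulr0.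
Qed.

Lemma central_class_sum f :
  central f -> f = \sum_mu hcoef f (w_part mu) *: Gamma mu.
Proof.
move=> fc; apply/eqP; rewrite -subr_eq0; apply/eqP/central_eq0 => [h|mu].
  rewrite /GRing.comm mulrBl mulrBr fc central_sum // => nu.
  exact: class_central.
by rewrite hcoefB hcoef_class_sum subrr.
Qed.

End ClassElements.

Lemma hcoef_hnorm1_w_part n (lam : intpart n) :
  hcoef (hnorm (T 1%g)) (w_part lam)
    = #|[set: 'S_n] : young_subgroup lam|%g%:R * 'X^(ell (w_part lam)).
Proof.
rewrite young_subgroupE w_partE; have ua := part_word_uniq lam (size lam).
by rewrite hcoef_hnorm1_wperm // -(eqP (uniq_reduced ua)).
Qed.

Theorem theorem6p3 (n : nat) (lam : intpart n) :
  (forall Gamma : intpart n -> hecke n, class_elements Gamma ->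
     (exists c : intpart n -> {poly int},
        hnorm (T 1%g) = \sum_(mu : intpart n) c mu *: Gamma mu) /\
     (forall c : intpart n -> {poly int},
        hnorm (T 1%g) = \sum_(mu : intpart n) c mu *: Gamma mu ->
        c lam = #|[set: 'S_n] : young_subgroup lam|%g%:R * 'X^(ell (w_part lam))))
  /\
  hform (hnorm (T 1%g)) (T (w_part lam))
    = #|[set: 'S_n] : young_subgroup lam|%g%:R * 'X^(ell (w_part lam)).
Proof.
split=> [Gamma GammaP|]; last by rewrite hformTr hcoef_hnorm1_w_part.
split.
  exists (fun mu => hcoef (hnorm (T 1%g)) (w_part mu)).
  exact/(central_class_sum GammaP)/hnorm1_central.
by move=> c E; rewrite -hcoef_hnorm1_w_part E hcoef_class_sum.
Qed.
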